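(* Let $f:[0,\infty)\to[0,\infty)$ be $2$-radical convex. Then $$f\left(\frac12\right)\le \int_0^1\left\{f\left(\frac{x+\frac12}{2}\right)+f\left(\frac{\left|x-\frac12\right|}{2}\right)\right\}dx\le \int_0^1 f(x)\,dx.$$
   Context: Let $p\ge 1$. A continuous function $f:[0,\infty)\to[0,\infty)$ with $f(0)=0$ is called $p$-radical convex if the function $x\mapsto f\left(x^{1/p}\right)$ is convex on $[0,\infty)$. In particular $f$ is $2$-radical convex if $x\mapsto f(\sqrt{x})$ is convex on $[0,\infty)$. *)

(* Defs.v *)
From HB Require Import structures.
From mathcomp Require Import all_boot all_order all_algebra.
From mathcomp Require Import all_classical all_reals all_analysis.

Set Implicit Arguments.
Unset Strict Implicit.
Unset Printing Implicit Defensive.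

Import Order.TTheory GRing.Theory Num.Theory.
Import numFieldNormedType.Exports.

Local Open Scope classical_set_scope.
Local Open Scope ring_scope.

(* A function from [0, +oo[ to [0, +oo[ is represented by a total [f : R -> R],
   constrained on [0, +oo[ only.  For p >= 1, [powR] agrees on [0, +oo[ with
   the usual p-th root (in particular it maps 0 to 0). *)
Record radical_convex (R : realType) (p : R) (f : R -> R) : Prop :=
  RadicalConvex {
    radical_convex_ge0 : forall x, 0 <= x -> 0 <= f x;
    radical_convex_continuous : {within `[0, +oo[, continuous f};
    radical_convex_0 : f 0 = 0;
    radical_convex_convex :
      convex_function (`[0, +oo[%classic : set R^o) (fun x => f (x `^ p^-1))
  }.

(* Main.v *)
(** By convexity of [t |-> f (sqrt t)] together with [f 0 = 0 <= f], for all [x, y >= 0],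
      f ((x + y) / 2) + f (|x - y| / 2) <= (f x + f y) / 2.
    In particular [f] is midpoint convex. Averaging midpoint convexity over
    [x] and [1 - x] gives [f (1/2) <= \int_0^1 f ((x + 1/2) / 2)], whence the left
    inequality, and also [f (1/2) <= \int_0^1 f]; integrating the pointwise
    inequality at [y = 1/2] then gives the right one. *)
Require Import Defs.
From HB Require Import structures.
From mathcomp Require Import all_boot all_order all_algebra.
From mathcomp Require Import all_classical all_reals all_analysis.
From mathcomp Require Import ring lra.

Import Order.TTheory GRing.Theory Num.Theory.
Import numFieldNormedType.Exports.

Local Open Scope classical_set_scope.
Local Open Scope ring_scope.

(** Relating the squares of the points eliminates square roots: each later use only has to check a
    rational identity, by [field] or [ring]. *)
Lemma radical_convex2_conv (R : realType) (f : R -> R) (t x y z : R) :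
  radical_convex 2 f -> 0 <= t <= 1 -> 0 <= x -> 0 <= y -> 0 <= z ->
  z ^+ 2 = t * x ^+ 2 + (1 - t) * y ^+ 2 ->
  f z <= t * f x + (1 - t) * f y.
Proof.
move=> [_ _ _ cf] /andP[t0 t1] x0 y0 z0 zE.
have sqrtE (u : R) : 0 <= u -> (u ^+ 2) `^ 2^-1 = u.
  by move=> u0; rewrite powR12_sqrt ?sqr_ge0// sqrtr_sqr ger0_norm.
have sqr_in (u : R) : u ^+ 2 \in (`[0, +oo[%classic : set R^o).
  by rewrite inE/= in_itv/= andbT sqr_ge0.
have := cf (Itv01 t0 t1) _ _ (sqr_in x) (sqr_in y).
rewrite /conv/= /convex.conv/= /unstable.onem.
rewrite !sqrtE//.
have -> : t *: (x ^+ 2 : R^o) + (1 - t) *: (y ^+ 2 : R^o) = z ^+ 2 by rewrite zE.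
by rewrite sqrtE.
Qed.

Lemma radical_convex2_star (R : realType) (f : R -> R) (t x z : R) :
  radical_convex 2 f -> 0 <= t <= 1 -> 0 <= x -> 0 <= z ->
  z ^+ 2 = t * x ^+ 2 -> f z <= t * f x.
Proof.
move=> hf t01 x0 z0 zE.
have := @radical_convex2_conv R f t x 0 z hf t01 x0 (lexx _) z0.
by rewrite (radical_convex_0 hf) mulr0 addr0; apply; rewrite zE; ring.
Qed.

(** For [y < x], the chord of [f (sqrt t)] from [y ^+ 2] to [x ^+ 2] bounds the first term, and what
    this leaves of [(f x + f y) / 2] is enough for the second. *)
Lemma radical_convex2_parallelogram (R : realType) (f : R -> R) (x y : R) :
  radical_convex 2 f -> 0 <= x -> 0 <= y ->
  f ((x + y) / 2) + f (`|x - y| / 2) <= (f x + f y) / 2.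
Proof.
move=> hf; wlog yx : x y / y <= x => [th x0 y0|x0 y0].
  have [|/ltW xy] := leP y x; first by move=> yx; exact: th.
  by rewrite distrC addrC [x + y]addrC [f x + _]addrC addrC; apply: th.
rewrite ger0_norm ?subr_ge0//.
(* The equal case is split off to have [x] and [x + y] positive: both occur in denominators
   below. *)
have [xE|xN] := eqVneq x y.
  rewrite xE subrr mul0r (radical_convex_0 hf) addr0.
  have -> : (y + y) / 2 = y by field.
  lra.
have {xN}yx : y < x by rewrite lt_neqAle eq_sym xN.
have xp : 0 < x by lra.
have xyp : 0 < x + y by lra.
have x2p : 0 < x ^+ 2 by rewrite exprn_gt0.
(* The weight solves [t * x ^+ 2 + (1 - t) * y ^+ 2 = ((x + y) / 2) ^+ 2]. *)
have h1 : f ((x + y) / 2) <= (x + 3 * y) / (4 * (x + y)) * f x +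
                             (1 - (x + 3 * y) / (4 * (x + y))) * f y.
  apply: radical_convex2_conv => //; [|lra|field; lra].
  by rewrite ler_pdivlMr ?ler_pdivrMr; lra.
have h2 : f ((x - y) / 2) <= ((x - y) / 2) ^+ 2 / x ^+ 2 * f x.
  apply: radical_convex2_star => //; [|lra|by field; lra].
  by rewrite ler_pdivlMr// ler_pdivrMr// mul0r mul1r; nra.
have h3 : f y <= y ^+ 2 / x ^+ 2 * f x.
  apply: radical_convex2_star => //; [|by field; lra].
  by rewrite ler_pdivlMr// ler_pdivrMr// mul0r mul1r; nra.
(* [k] is [1 / 2] minus the weight of [f x] in [h1]; moreover [k * (x ^+ 2 - y ^+ 2) = ((x - y) / 2)
   ^+ 2]. *)
pose k := (x - y) / (4 * (x + y)).
have k0 : 0 <= k by rewrite divr_ge0//; lra.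
(* [t |-> f (sqrt t)] is superadditive, being star-shaped. *)
have h4 : f ((x - y) / 2) <= k * (f x - f y).
  apply: (le_trans h2).
  have -> : ((x - y) / 2) ^+ 2 / x ^+ 2 * f x =
            k * (f x - y ^+ 2 / x ^+ 2 * f x) by rewrite /k; field; lra.
  by rewrite ler_wpM2l// lerD2l lerN2.
have -> : (f x + f y) / 2 = (x + 3 * y) / (4 * (x + y)) * f x +
    (1 - (x + 3 * y) / (4 * (x + y))) * f y + k * (f x - f y).
  by rewrite /k; field; lra.
exact: lerD.
Qed.

Lemma radical_convex2_midpoint (R : realType) (f : R -> R) (x y : R) :
  radical_convex 2 f -> 0 <= x -> 0 <= y -> f ((x + y) / 2) <= (f x + f y) / 2.
Proof.
move=> hf x0 y0; apply: le_trans (radical_convex2_parallelogram _ _ _ _ hf x0 y0).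
by rewrite lerDl (radical_convex_ge0 hf)// divr_ge0.
Qed.

(** The absolute value lands in the half-line, so continuity relative to the half-line suffices,
    even at 0. *)
Lemma continuous_comp_normr (R : realType) (f : R -> R) :
  {within `[0, +oo[, continuous f} -> continuous (fun x : R => f `|x|).
Proof.
move=> /subspace_continuousP cf x.
have x0 : `[0, +oo[%classic `|x| by rewrite /= in_itv/= andbT.
apply: (@cvg_comp _ _ _ Num.norm f _ (within `[0, +oo[ (nbhs `|x|))); last exact: cf.
move=> A; rewrite /within/= => hA.
have nA : \forall y \near x, `|y| \in `[0, +oo[ -> A `|y|
  := @norm_continuous R R x _ hA.
by apply: filterS nA => y; apply; rewrite in_itv/= andbT.
Qed.

Lemma integrable01_continuous (R : realType) (h : R -> R) : continuous h ->
  (@lebesgue_measure R).-integrable `[0, 1] (EFin \o h).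
Proof.
move=> ch; apply: continuous_compact_integrable; first exact: segment_compact.
exact: continuous_subspaceT.
Qed.

Lemma Rintegral01_cst (R : realType) (c : R) :
  \int[lebesgue_measure]_(x in `[0, 1]) (c : R) = c.
Proof.
rewrite Rintegral_cst; last exact: measurable_itv.
by rewrite [X in fine X]lebesgue_measure_itv/= lte_fin ltr01 oppr0 adde0 mulr1.
Qed.

(** The reflection of [[0, 1]] about its midpoint preserves the integral, so [h x + h (1 - x)]
    integrates to twice the integral of [h]. *)
Lemma le_Rintegral01_onem (R : realType) (c : R) (h : R -> R) : continuous h ->
  (forall x, 0 <= x <= 1 -> 2 * c <= h x + h (1 - x)) ->
  c <= \int[lebesgue_measure]_(x in `[0, 1]) h x.
Proof.
move=> ch hc.
have ch' : continuous (fun x : R => h (1 - x)).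
  move=> x; apply: (continuous_comp (f := fun x : R => 1 - x)); last exact: ch.
  by apply: continuousB => //; exact: cst_continuous.
have E : \int[lebesgue_measure]_(x in `[0, 1]) h x =
           \int[lebesgue_measure]_(x in `[0, 1]) h (1 - x).
  rewrite (Rintegration_by_substitution_onem (r := 1)) ?unstable.onem1//.
    by rewrite ler01 lexx.
  exact: continuous_subspaceT.
have : 2 * c <= \int[lebesgue_measure]_(x in `[0, 1]) (h x + h (1 - x)).
  rewrite -[leLHS]Rintegral01_cst.
  apply: le_Rintegral => [|||x /=].
  - exact: measurable_itv.
  - by apply: integrable01_continuous; exact: cst_continuous.
  - apply: integrable01_continuous => x.
    by apply: continuousD; [exact: ch|exact: ch'].
  - by rewrite in_itv/=; exact: hc.
rewrite RintegralD; [|exact: measurable_itv|exact: integrable01_continuous..].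
rewrite -E; lra.
Qed.

Theorem theorem2p3 (R : realType) (f : R -> R) (hf : radical_convex 2 f) :
  f (1 / 2) <=
    \int[lebesgue_measure]_(x in `[0, 1])
      (f ((x + 1 / 2) / 2) + f (`|x - 1 / 2| / 2)) /\
  \int[lebesgue_measure]_(x in `[0, 1])
      (f ((x + 1 / 2) / 2) + f (`|x - 1 / 2| / 2)) <=
    \int[lebesgue_measure]_(x in `[0, 1]) f x.
Proof.
(* Extending [f] evenly makes all the integrands continuous on the whole line. *)
pose F (x : R) := f `|x|.
have cF : continuous F.
  by apply: continuous_comp_normr; exact: radical_convex_continuous hf.
have FE x : 0 <= x -> F x = f x by move=> x0; rewrite /F ger0_norm.
have cFa (a : R) : continuous (fun x : R => F ((x + a) / 2)).
  move=> x; apply: (continuous_comp (f := fun x : R => (x + a) / 2)); last exact: cF.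
  apply: continuousM; last exact: cst_continuous.
  by apply: continuousD => //; exact: cst_continuous.
have cG : continuous (fun x : R => F ((x + 1 / 2) / 2) + F ((x + - (1 / 2)) / 2)).
  by move=> x; exact: (cvgD (cFa _ x) (cFa _ x)).
rewrite (@eq_Rintegral _ _ _ lebesgue_measure _
  (fun x => F ((x + 1 / 2) / 2) + F ((x + - (1 / 2)) / 2)) (fun x => _ + _)); last first.
  move=> x; rewrite inE/= in_itv/= => /andP[x0 _]; congr (_ + _).
    by rewrite FE//; lra.
  by rewrite /F normrM [ `|2^-1| ]ger0_norm.
rewrite (@eq_Rintegral _ _ _ lebesgue_measure _ F f); last first.
  by move=> x; rewrite inE/= in_itv/= => /andP[x0 _]; rewrite FE.
have half_le : f (1 / 2) <= \int[lebesgue_measure]_(x in `[0, 1]) F x.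
  apply: le_Rintegral01_onem => // x /andP[x0 x1]; rewrite !FE ?subr_ge0//.
  have x1' : 0 <= 1 - x by lra.
  have := radical_convex2_midpoint _ _ _ _ hf x0 x1'.
  by rewrite addrC subrK; lra.
split.
  apply: le_Rintegral01_onem => // x /andP[x0 x1].
  have u0 : 0 <= (x + 1 / 2) / 2 by lra.
  have v0 : 0 <= (1 - x + 1 / 2) / 2 by lra.
  (* The first terms at [x] and [1 - x] have arguments averaging to [1 / 2]; the second terms are
     dropped as nonnegative. *)
  have := radical_convex2_midpoint _ _ _ _ hf u0 v0.
  have -> : ((x + 1 / 2) / 2 + (1 - x + 1 / 2) / 2) / 2 = 1 / 2 :> R by field.
  have F0 y : 0 <= F y by rewrite (radical_convex_ge0 hf).
  have := F0 ((x + - (1 / 2)) / 2); have := F0 ((1 - x + - (1 / 2)) / 2).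
  rewrite (FE _ u0) (FE _ v0); lra.
have cK : continuous (fun x : R => F x + f (1 / 2)).
  by move=> x; exact: (cvgD (cF x) (cvg_cst _)).
have cH : continuous (fun x : R => 2^-1 * (F x + f (1 / 2))).
  by move=> x; exact: (cvgM (cvg_cst _) (cK x)).
(* The parallelogram bound at [y = 1 / 2] integrates to the mean of the integral of [F] and
   [f (1 / 2)], and [half_le] bounds the latter by the former. *)
apply: (@le_trans _ _
    (\int[lebesgue_measure]_(x in `[0, 1]) (2^-1 * (F x + f (1 / 2))))).
  apply: le_Rintegral; [exact: measurable_itv|exact: integrable01_continuous..|].
  move=> x /=; rewrite in_itv/= => /andP[x0 _].
  have h0 : 0 <= 1 / 2 :> R by lra.
  have := radical_convex2_parallelogram _ _ _ _ hf x0 h0.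
  by rewrite mulrC FE ?[F ((x + - _) / _)]/F ?normrM ?[ `|2^-1| ]ger0_norm ?FE//; lra.
rewrite RintegralZl; [|exact: measurable_itv|exact: integrable01_continuous].
rewrite RintegralD; [|exact: measurable_itv|exact: integrable01_continuous|].
  rewrite Rintegral01_cst; lra.
by apply: integrable01_continuous; exact: cst_continuous.
Qed.
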